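(* Let $1\le r\le2$, let $h(x)=|x|^r$ for $x\in\mathbb R$, so that $h^{-1}(y)=y^{1/r}$ for $y\ge0$, and let $g:[0,\infty)\to(0,\infty)$ be a positive increasing function. Then in the unbounded forecasting game with general hedge $h$ (UFGH) Reality strongly complies with the event $$\sum_n\frac{v_n}{g(A_n)}=\infty\ \Rightarrow\ \frac{\sum_{k=1}^n(x_k-m_k)}{h^{-1}(g(A_n))}\ \text{ does not converge (as } n\to\infty),$$ where $A_n=\sum_{k=1}^n v_k$.
   Context: Unbounded forecasting game with general hedge $h:\mathbb R\to\mathbb R$ (UFGH): $\mathcal K_0=1$. For $n=1,2,\ldots$: Forecaster announces $m_n\in\mathbb R$ and $v_n>0$; Skeptic announces $M_n\in\mathbb R$ and $V_n\ge0$; Reality announces $x_n\in\mathbb R$; and $\mathcal K_n:=\mathcal K_{n-1}+M_n(x_n-m_n)+V_n(h(x_n-m_n)-v_n)$. All moves are public. Skeptic's collateral duty is to keep $\mathcal K_n$ non-negative; Forecaster has no duty other than making allowed moves. A path is an infinite sequence $\xi=(m_1,v_1,x_1,m_2,v_2,x_2,\ldots)$ of allowed moves of Forecaster and Reality; $\Xi$ is the set of paths; an event is any subset of $\Xi$. For events, $E_1\Rightarrow E_2$ denotes $E_1^c\cup E_2$. ''Converges'' means converges to a finite real limit. Write $\mu_n=(m_n,v_n)$ and $\mathfrak m_n=(M_n,V_n)$. A (deterministic) strategy of Reality is a sequence $\mathcal R=\{\mathcal R_n\}_{n\ge1}$ of functions with $x_n=\mathcal R_n(\mu_1,\mathfrak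 m_1,\ldots,\mu_n,\mathfrak m_n)$. By $\mathcal R$ Reality strongly complies with an event $E$ if, irrespective of the moves $\mu_n,\mathfrak m_n$, $n\ge1$, of Forecaster and Skeptic, both observing their collateral duties, when Reality plays $\mathcal R$: (i) the resulting path $(\mu_1,x_1,\mu_2,x_2,\ldots)$ belongs to $E$, and (ii) $\mathcal K_n\le1=\mathcal K_0$ for all $n$. Reality strongly complies with $E$ if such an $\mathcal R$ exists. *)

(* Defs.v *)
From mathcomp Require Import all_boot all_order all_algebra.
From mathcomp Require Import all_classical all_reals all_analysis.

Set Implicit Arguments.
Unset Strict Implicit.
Unset Printing Implicit Defensive.

Import Order.TTheory GRing.Theory Num.Theory.
Import numFieldNormedType.Exports.

Local Open Scope classical_set_scope.
Local Open Scope ring_scope.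

(* Sequences of moves are indexed from 0: index n holds the moves of round
   n + 1. Allowed moves are enforced by the types. *)

(* (m, v) with v > 0 *)
Definition forecaster_move (R : realType) : Type := (R * {posnum R})%type.

(* (M, V) with V >= 0 *)
Definition skeptic_move (R : realType) : Type := (R * {nonneg R})%type.

(* The set of all paths is the whole type, so that an event is a
   [set (game_path R)] and complements of events are taken in it. *)
Definition game_path (R : realType) : Type := nat -> forecaster_move R * R.

Definition path_m (R : realType) (xi : game_path R) (n : nat) : R := (xi n).1.1.
Definition path_v (R : realType) (xi : game_path R) (n : nat) : R :=
  (xi n).1.2%:num.
Definition path_x (R : realType) (xi : game_path R) (n : nat) : R := (xi n).2.

Definition event_imply (R : realType) (E1 E2 : set (game_path R)) : set (game_path R) :=
  ~` E1 `|` E2.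

(* Skeptic's capital after n rounds. *)
Fixpoint capital (R : realType) (h : R -> R) (xi : game_path R)
    (s : nat -> skeptic_move R) (n : nat) : R :=
  if n is k.+1 then
    let d := path_x xi k - path_m xi k in
    capital h xi s k + (s k).1 * d + (s k).2%:num * (h d - path_v xi k)
  else 1.

(* The n-th function receives the moves of Forecaster and Skeptic in all
   rounds up to and including the current one. *)
Definition reality_strategy (R : realType) : Type :=
  forall n : nat, n.+1.-tuple (forecaster_move R * skeptic_move R) -> R.

Definition play (R : realType) (strat : reality_strategy R)
    (mu : nat -> forecaster_move R) (s : nat -> skeptic_move R) : game_path R :=
  fun n => (mu n, strat n [tuple (mu i, s i) | i < n.+1]).

(* Skeptic's collateral duty is the nonnegativity of the capital along the
   realized play; Forecaster's only duty is to make allowed moves. *)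
Definition strongly_complies_by (R : realType) (h : R -> R)
    (strat : reality_strategy R) (E : set (game_path R)) : Prop :=
  forall (mu : nat -> forecaster_move R) (s : nat -> skeptic_move R),
    let xi := play strat mu s in
    (forall n, 0 <= capital h xi s n) ->
    E xi /\ (forall n, capital h xi s n <= 1).

Definition reality_strongly_complies (R : realType) (h : R -> R)
    (E : set (game_path R)) : Prop :=
  exists strat : reality_strategy R, strongly_complies_by h strat E.

Definition power_hedge (R : realType) (r : R) : R -> R := fun x => `|x| `^ r.

(* The inverse of [power_hedge r] on nonnegative reals. *)
Definition power_hedge_inv (R : realType) (r : R) : R -> R :=
  fun y => y `^ r^-1.

(* Sums over the first n rounds. *)
Definition cumul_v (R : realType) (xi : game_path R) (n : nat) : R :=
  \sum_(k < n) path_v xi k.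
Definition cumul_dev (R : realType) (xi : game_path R) (n : nat) : R :=
  \sum_(k < n) (path_x xi k - path_m xi k).

(* Main.v *)
Require Import Defs.
From mathcomp Require Import all_boot all_order all_algebra.
From mathcomp Require Import all_classical all_reals all_analysis.
From mathcomp Require Import lra.

(** Put [b y = h^-1 (g y)], and let [Y n = S_n / b (A_n)] be the normalised sum
    of the deviations [x_k - m_k]. In each round Reality deviates either by [0]
    or by a jump of size [b (A_n)], so that [h] of the jump is [g (A_n)], with
    the sign for which Skeptic's linear bet [M_n] does not gain. A jump raises
    the capital by at most [V_n g (A_n)]; call the round affordable if this is
    at most the slack [1 - K_(n-1)]. Then the capital stays below [1] provided
    that Reality jumps in affordable rounds only.

    In an affordable round both options are open, and they lead to values of
    [Y n] at distance [1] from each other, so one of them is at distance at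
    least [1/2] from [Y (n-1)]: Reality takes it ([affordable_moves]). Hence [Y]
    does not converge if affordable rounds recur for ever.

    In an unaffordable round Reality deviates by [0], and Skeptic loses
    [V_n v_n > (1 - K_(n-1)) v_n / g (A_n)] ([unaffordable_loss]). If all the
    rounds from some point on are unaffordable, the slack no longer decreases and
    is positive after the first of them, so the total loss dominates a positive
    multiple of a tail of [\sum_n v_n / g (A_n)]. As the capital stays
    nonnegative, this series is then bounded
    ([unaffordable_tail_bounds_series]). *)

Set Implicit Arguments.
Unset Strict Implicit.
Unset Printing Implicit Defensive.

Import Order.TTheory GRing.Theory Num.Theory.
Import numFieldNormedType.Exports.

Local Open Scope classical_set_scope.
Local Open Scope ring_scope.

(** * Reality's strategy *)

(** Skeptic's capital, [A_n] and [S_n]. *)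
Definition game_state (R : realType) : Type := (R * R * R)%type.

Definition round_moves (R : realType) : Type :=
  (forecaster_move R * skeptic_move R)%type.

Definition affordable (R : realType) (g : R -> R) (st : game_state R)
    (mv : round_moves R) : bool :=
  mv.2.2%:num * g (st.1.2 + mv.1.2%:num) <= 1 - st.1.1.

Definition jump (R : realType) (b : R -> R) (st : game_state R)
    (mv : round_moves R) : R :=
  (if 0 <= mv.2.1 then -1 else 1) * b (st.1.2 + mv.1.2%:num).

(** The value of [S / b A] after a deviation by [d]. *)
Definition next_ratio (R : realType) (b : R -> R) (st : game_state R)
    (mv : round_moves R) (d : R) : R :=
  (st.2 + d) / b (st.1.2 + mv.1.2%:num).

Definition ratio (R : realType) (b : R -> R) (st : game_state R) : R :=
  st.2 / b st.1.2.

Definition deviation (R : realType) (g b : R -> R) (st : game_state R)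
    (mv : round_moves R) : R :=
  if affordable g st mv &&
     (2^-1 <= `|next_ratio b st mv (jump b st mv) - ratio b st|)
  then jump b st mv else 0.

Definition next_state (R : realType) (h g b : R -> R) (st : game_state R)
    (mv : round_moves R) : game_state R :=
  let d := deviation g b st mv in
  (st.1.1 + mv.2.1 * d + mv.2.2%:num * (h d - mv.1.2%:num),
   st.1.2 + mv.1.2%:num, st.2 + d).

Definition state_after (R : realType) (h g b : R -> R)
    (mvs : seq (round_moves R)) : game_state R :=
  foldl (next_state h g b) (1, 0, 0) mvs.

(** Reality's own past moves are not among the arguments of a strategy; they are
    recovered by replaying the earlier rounds. *)
Definition jump_strategy (R : realType) (h g b : R -> R) :
    reality_strategy R :=
  fun n t => (tnth t ord_max).1.1
    + deviation g b (state_after h g b (take n t)) (tnth t ord_max).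

Definition run_state (R : realType) (h g b : R -> R)
    (mu : nat -> forecaster_move R) (s : nat -> skeptic_move R) (n : nat) :
    game_state R :=
  state_after h g b (mkseq (fun i => (mu i, s i)) n).

Lemma run_stateS (R : realType) (h g b : R -> R)
    (mu : nat -> forecaster_move R) (s : nat -> skeptic_move R) (n : nat) :
  run_state h g b mu s n.+1
  = next_state h g b (run_state h g b mu s n) (mu n, s n).
Proof. by rewrite /run_state mkseqS /state_after foldl_rcons. Qed.

Lemma take_mktuple (T : Type) (f : nat -> T) (n : nat) :
  take n [tuple f i | i < n.+1] = mkseq f n.
Proof.
have -> : tval [tuple f i | i < n.+1] = mkseq f n.+1.
  by rewrite /= /mkseq -val_enum_ord -map_comp enumT.
by rewrite mkseqS -cats1 take_size_cat // size_mkseq.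
Qed.

Lemma jump_strategy_deviation (R : realType) (h g b : R -> R)
    (mu : nat -> forecaster_move R) (s : nat -> skeptic_move R) (n : nat) :
  let xi := play (jump_strategy h g b) mu s in
  path_x xi n - path_m xi n
  = deviation g b (run_state h g b mu s n) (mu n, s n).
Proof.
rewrite /path_x /path_m /= /jump_strategy.
rewrite (@take_mktuple _ (fun i => (mu i, s i))) tnth_mktuple /=.
by rewrite addrAC subrr add0r.
Qed.

Lemma run_stateE (R : realType) (h g b : R -> R)
    (mu : nat -> forecaster_move R) (s : nat -> skeptic_move R) (n : nat) :
  let xi := play (jump_strategy h g b) mu s in
  run_state h g b mu s n = (capital h xi s n, cumul_v xi n, cumul_dev xi n).
Proof.
move=> xi; elim: n => [|n IHn]; first by rewrite /cumul_v /cumul_dev !big_ord0.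
rewrite run_stateS /cumul_v /cumul_dev !big_ord_recr /=.
rewrite -/(cumul_v xi n) -/(cumul_dev xi n).
by rewrite /xi jump_strategy_deviation -/xi IHn.
Qed.

(** * One round *)

Section OneRound.
Context (R : realType) (h g b : R -> R).
Context (h0 : h 0 = 0).
Context (g_gt0 : forall y, 0 <= y -> 0 < g y).
Context (b_gt0 : forall y, 0 <= y -> 0 < b y).
Context (h_b : forall y, 0 <= y -> h (b y) = g y).
Context (h_Nb : forall y, 0 <= y -> h (- b y) = g y).
Context (st : game_state R) (mv : round_moves R).
Context (A_ge0 : 0 <= st.1.2).

Let A'_ge0 : 0 <= st.1.2 + mv.1.2%:num.
Proof. by rewrite addr_ge0. Qed.

Lemma h_jump : h (jump b st mv) = g (st.1.2 + mv.1.2%:num).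
Proof.
by rewrite /jump; case: ifP => _; rewrite ?mulN1r ?mul1r ?h_b ?h_Nb.
Qed.

Lemma jump_against_bet : mv.2.1 * jump b st mv <= 0.
Proof.
have b0 := b_gt0 A'_ge0; rewrite /jump; case: ifPn => [M0|].
  by rewrite mulN1r mulrN oppr_le0 mulr_ge0 // ltW.
by rewrite -ltNge mul1r => M0; rewrite mulr_le0_ge0 // ltW.
Qed.

Lemma next_capital_le1 :
  st.1.1 <= 1 -> (next_state h g b st mv).1.1 <= 1.
Proof.
move=> K1; rewrite /next_state /= /deviation.
have Vv0 : 0 <= mv.2.2%:num * mv.1.2%:num by rewrite mulr_ge0.
case: ifPn => [/andP[aff _]|_].
  rewrite h_jump mulrBr; have := jump_against_bet.
  by move: aff; rewrite /affordable; lra.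
by rewrite h0; lra.
Qed.

(** The two options differ by [1] after division by [b], so they cannot both be
    within less than [1/2] of the current ratio. *)
Lemma affordable_moves :
  affordable g st mv ->
  2^-1 <= `|ratio b (next_state h g b st mv) - ratio b st|.
Proof.
move=> aff; have b0 := b_gt0 A'_ge0.
rewrite {1}/ratio /next_state /= /deviation aff /=.
case: ifPn => // far; rewrite addr0.
have : `|next_ratio b st mv (jump b st mv) - st.2 / b (st.1.2 + mv.1.2%:num)|
    = 1.
  rewrite /next_ratio -mulrBl addrAC subrr add0r /jump.
  rewrite mulfK ?gt_eqF //.
  by case: ifP => _; rewrite ?normrN normr1.
rewrite -ltNge in far.
have := ler_distD (ratio b st) (next_ratio b st mv (jump b st mv))
  (st.2 / b (st.1.2 + mv.1.2%:num)).
rewrite (distrC (ratio b st)) => tri one; move: far tri; rewrite one; lra.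
Qed.

Lemma unaffordable_loss :
  ~~ affordable g st mv ->
  (next_state h g b st mv).1.1
  < st.1.1 - (1 - st.1.1) * (mv.1.2%:num / g (st.1.2 + mv.1.2%:num)).
Proof.
move=> naff; rewrite /next_state /deviation (negbTE naff) /= h0.
rewrite mulr0 addr0 add0r mulrN ltrD2l ltrN2 mulrA mulrAC.
rewrite ltr_pM2r // ltr_pdivrMr ?g_gt0 //.
by rewrite ltNge.
Qed.

End OneRound.

(** * The infinite game *)

(** The slack [1 - K n] is positive at [N.+1], because the loss in round [N] is
    strict, and it never decreases afterwards; so each later term [p n] costs
    Skeptic at least [(1 - K N.+1) * p n] out of a capital that is at most [1]. *)
Lemma unaffordable_tail_bounds_series (R : realType) (K p : nat -> R) (N : nat) :
  (forall n, 0 <= p n) -> (forall n, 0 <= K n) -> (forall n, K n <= 1) ->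
  (forall n, (N <= n)%N -> K n.+1 < K n - (1 - K n) * p n) ->
  (\sum_(0 <= n <oo) (p n)%:E < +oo)%E.
Proof.
move=> p0 K0 K1 loss.
pose c := 1 - K N.+1.
have c0 : 0 < c.
  have := loss _ (leqnn N); have : 0 <= (1 - K N) * p N.
    by rewrite mulr_ge0 // subr_ge0.
  by rewrite /c; have := K1 N; lra.
have tail m : c * \sum_(N.+1 <= k < N.+1 + m) p k <= K N.+1 - K (N.+1 + m)%N
    /\ c <= 1 - K (N.+1 + m)%N.
  elim: m => [|m [IH1 IH2]].
    by rewrite addn0 big_geq // mulr0 subrr.
  rewrite addnS big_nat_recr ?leq_addr //= mulrDr.
  have Nm : (N <= N.+1 + m)%N by rewrite addSn (leq_trans (leq_addr m N)).
  have := loss _ Nm.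
  have : c * p (N.+1 + m)%N <= (1 - K (N.+1 + m)%N) * p (N.+1 + m)%N.
    by rewrite ler_wpM2r.
  have : 0 <= c * p (N.+1 + m)%N by rewrite mulr_ge0 // ltW.
  by split; lra.
apply: (@le_lt_trans _ _ (\sum_(0 <= k < N.+1) p k + c^-1)%:E);
  last exact: ltry.
apply: lime_le.
  by apply: is_cvg_nneseries => n _ _; rewrite lee_fin.
exists N.+1 => // n /= Nn; rewrite sumEFin lee_fin.
rewrite (big_cat_nat _ (n := N.+1)) //= lerD2l.
rewrite -(subnKC Nn) -(ler_pM2l c0) divff ?gt_eqF //.
have [+ _] := tail (n - N.+1)%N.
by have := K1 N.+1; have := K0 (N.+1 + (n - N.+1))%N; lra.
Qed.

Lemma cvg_steps_small (R : realType) (u : nat -> R) (e : R) :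
  0 < e -> cvgn u -> exists N, forall n, (N <= n)%N -> `|u n.+1 - u n| < e.
Proof.
move=> e0 cu.
have : (fun n => u n.+1 - u n) @ \oo --> (0 : R).
  rewrite -(subrr (limn u)); apply: cvgB => //.
  by rewrite (cvg_shiftS u).
move=> /cvgr0Pnorm_lt /(_ e e0) [N _ HN].
by exists N => n Nn; apply: HN.
Qed.

(** The normalising function [b] stands for [h^-1 \o g]. *)
Lemma jump_strategy_complies (R : realType) (h g b : R -> R) :
  h 0 = 0 ->
  (forall y, 0 <= y -> 0 < g y) -> (forall y, 0 <= y -> 0 < b y) ->
  (forall y, 0 <= y -> h (b y) = g y) ->
  (forall y, 0 <= y -> h (- b y) = g y) ->
  strongly_complies_by h (jump_strategy h g b)
    (event_imply
      [set xi : game_path R |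
        (\sum_(0 <= n <oo) (path_v xi n / g (cumul_v xi n.+1))%:E = +oo)%E]
      [set xi : game_path R |
        ~ cvgn (fun n : nat => cumul_dev xi n.+1 / b (cumul_v xi n.+1))]).
Proof.
move=> h0 g_gt0 b_gt0 h_b h_Nb mu s xi K_ge0.
pose st := run_state h g b mu s; pose mv n : round_moves R := (mu n, s n).
have stE n : st n = (capital h xi s n, cumul_v xi n, cumul_dev xi n).
  exact: run_stateE.
have stS n : st n.+1 = next_state h g b (st n) (mv n) by exact: run_stateS.
have A_ge0 n : 0 <= (st n).1.2.
  by rewrite stE; apply: sumr_ge0 => i _; rewrite /path_v.
have K_le1 n : (st n).1.1 <= 1.
  elim: n => [|n IHn]; first by rewrite stE.
  by rewrite stS; apply: next_capital_le1.
split; last by move=> n; have := K_le1 n; rewrite stE.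
have [diverges|] := pselect
  ((\sum_(0 <= n <oo) (path_v xi n / g (cumul_v xi n.+1))%:E)%E = +oo%E);
  last by left.
right=> /= cY.
have [N steps] := cvg_steps_small (e := 2^-1) ltac:(lra) cY.
suff : (\sum_(0 <= n <oo) (path_v xi n / g (cumul_v xi n.+1))%:E < +oo)%E.
  by rewrite diverges ltxx.
have AS n : cumul_v xi n.+1 = (st n).1.2 + (mv n).1.2%:num.
  by rewrite stE /cumul_v big_ord_recr.
apply: (@unaffordable_tail_bounds_series _ (fun n => (st n).1.1) _ N.+1).
- move=> n; rewrite divr_ge0 /path_v // AS ltW // g_gt0 // addr_ge0 //.
- by move=> n; rewrite stE; apply: K_ge0.
- exact: K_le1.
- (* The convergent sequence has the ratio of state [n.+1] at index [n], so that
     round [n.+1] accounts for its [n]-th step; hence the shift to [N.+1]. *)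
  move=> [//|n] Nn; rewrite stS AS; apply: unaffordable_loss => //.
  apply/negP => /(affordable_moves h b_gt0 (A_ge0 _)).
  rewrite -stS /ratio !stE /= => far.
  by have := lt_le_trans (steps n Nn) far; rewrite ltxx.
Qed.

Theorem theorem5p10 (R : realType) (r : R) (g : R -> R)
    (hr : 1 <= r <= 2)
    (g_gt0 : forall y : R, 0 <= y -> 0 < g y)
    (g_incr : forall y z : R, 0 <= y -> y <= z -> g y <= g z) :
  reality_strongly_complies (power_hedge r)
    (event_imply
      [set xi : game_path R |
        (\sum_(0 <= n <oo) (path_v xi n / g (cumul_v xi n.+1))%:E = +oo)%E]
      [set xi : game_path R |
        ~ cvgn (fun n : nat =>
            cumul_dev xi n.+1 /
              power_hedge_inv r (g (cumul_v xi n.+1)))]).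
Proof.
have r_gt0 : 0 < r by move: hr => /andP[? _]; lra.
pose b := fun y => power_hedge_inv r (g y).
have h_b y : 0 <= y -> power_hedge r (b y) = g y.
  move=> y0; rewrite /power_hedge /b /power_hedge_inv.
  rewrite ger0_norm ?powR_ge0 // -powRrM mulVf ?gt_eqF // powRr1 //.
  by rewrite ltW ?g_gt0.
exists (jump_strategy (power_hedge r) g b).
apply: jump_strategy_complies => //.
- by rewrite /power_hedge normr0 powR0 // gt_eqF.
- by move=> y y0; rewrite powR_gt0 // g_gt0.
- by move=> y y0; rewrite /power_hedge normrN; apply: h_b.
Qed.
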